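(* Let $G$ be a connected simple graph on $n \ge 5$ vertices with $m$ edges and minimum degree $\delta(G)\ge 2$. If \[ m \ge \binom{n-2}{2} + 4, \] then $G$ is pancyclic, unless $G$ is bipartite or $G$ belongs to the family \[ \{K_2\vee(K_{n-4}+2K_1),\ K_5\vee 6K_1,\ K_3\vee(K_2+3K_1),\ K_3\vee(K_1+K_{1,4}),\ K_3\vee(K_2+K_{1,3}),\ (K_2\vee 2K_1)\vee 5K_1,\ K_4\vee 5K_1,\ K_{1,2}\vee 4K_1,\ K_2\vee(K_1+K_{1,3}),\ K_3\vee 4K_1\}. \]
   Context: All graphs are finite, simple and undirected. A graph on $n$ vertices is pancyclic if it contains a cycle of every length $l$ with $3\le l\le n$. $K_n$ denotes the complete graph on $n$ vertices and $K_{a,b}$ the complete bipartite graph with parts of sizes $a$ and $b$. For disjoint graphs $G,H$, $G+H$ denotes their disjoint union, $kG$ denotes the disjoint union of $k$ copies of $G$, and $G\vee H$ (the join) is obtained from $G+H$ by adding all edges between a vertex of $G$ and a vertex of $H$. *)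

(* Defs.v *)
From HB Require Import structures.
From mathcomp Require Import all_boot.

Set Implicit Arguments.
Unset Strict Implicit.
Unset Printing Implicit Defensive.

Record sgraph := SGraph {
  vertex :> finType;
  adj : rel vertex;
  adj_sym : symmetric adj;
  adj_irrefl : irreflexive adj
}.

Section Invariants.
Variable G : sgraph.

Definition edges : {set {set G}} :=
  [set [set p.1; p.2] | p : G * G & adj p.1 p.2].

Definition degree (x : G) : nat := #|[set y | adj x y]|.

(* Every degree is < #|G|, so on a nonempty graph the default value #|G| is
   never attained and this is the true minimum. *)
Definition min_degree : nat := \big[minn/#|G|]_(x : G) degree x.

Definition connected : Prop :=
  0 < #|G| /\ forall x y : G, connect (@adj G) x y.

Definition bipartite : Prop :=
  exists A : {set G}, forall x y : G, adj x y -> (x \in A) != (y \in A).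

(* Meaningful for l >= 3 only: [ucycle] also accepts the empty sequence and the
   two ends of an edge. *)
Definition has_cycle (l : nat) : Prop :=
  exists c : seq G, ucycle (@adj G) c /\ size c = l.

Definition pancyclic : Prop :=
  forall l : nat, 3 <= l <= #|G| -> has_cycle l.

End Invariants.

Definition isomorphic (G H : sgraph) : Prop :=
  exists f : G -> H, bijective f /\ forall x y : G, adj (f x) (f y) = adj x y.

Section Complete.
Variable n : nat.

Definition complete_adj : rel 'I_n := fun x y => x != y.

Lemma complete_sym : symmetric complete_adj.
Proof. by move=> x y; rewrite /complete_adj eq_sym. Qed.

Lemma complete_irrefl : irreflexive complete_adj.
Proof. by move=> x; rewrite /complete_adj eqxx. Qed.

Definition K : sgraph := SGraph complete_sym complete_irrefl.

End Complete.

Section CompleteBipartite.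
Variables a b : nat.

Definition complete_bip_adj : rel ('I_a + 'I_b) := fun x y =>
  match x, y with
  | inl _, inr _ | inr _, inl _ => true
  | _, _ => false
  end.

Lemma complete_bip_sym : symmetric complete_bip_adj.
Proof. by case=> x [] y. Qed.

Lemma complete_bip_irrefl : irreflexive complete_bip_adj.
Proof. by case. Qed.

Definition Kbip : sgraph := SGraph complete_bip_sym complete_bip_irrefl.

End CompleteBipartite.

Section UnionJoin.
Variables G H : sgraph.

Definition sum_adj (cross : bool) : rel (G + H) := fun x y =>
  match x, y with
  | inl u, inl v => adj u v
  | inr u, inr v => adj u v
  | _, _ => cross
  end.

Lemma sum_adj_sym cross : symmetric (sum_adj cross).
Proof. by case=> x [] y //=; rewrite adj_sym. Qed.

Lemma sum_adj_irrefl cross : irreflexive (sum_adj cross).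
Proof. by case=> x /=; rewrite adj_irrefl. Qed.

Definition disjoint_union : sgraph :=
  SGraph (sum_adj_sym false) (sum_adj_irrefl false).

Definition graph_join : sgraph :=
  SGraph (sum_adj_sym true) (sum_adj_irrefl true).

End UnionJoin.

Section Copies.
Variables (k : nat) (G : sgraph).

Definition copies_adj : rel ('I_k * G) := fun x y =>
  (x.1 == y.1) && adj x.2 y.2.

Lemma copies_sym : symmetric copies_adj.
Proof. by move=> x y; rewrite /copies_adj eq_sym adj_sym. Qed.

Lemma copies_irrefl : irreflexive copies_adj.
Proof. by move=> x; rewrite /copies_adj adj_irrefl andbF. Qed.

Definition copies : sgraph := SGraph copies_sym copies_irrefl.

End Copies.

Declare Scope graph_scope.
Delimit Scope graph_scope with graph.
Bind Scope graph_scope with sgraph.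
Notation "G + H" := (disjoint_union G H) : graph_scope.
Notation "G \vee H" := (graph_join G H)
  (at level 50, left associativity) : graph_scope.

Definition exceptional (n : nat) (G : sgraph) : Prop :=
  isomorphic G (K 2 \vee (K (n - 4) + copies 2 (K 1))) \/
  isomorphic G (K 5 \vee copies 6 (K 1)) \/
  isomorphic G (K 3 \vee (K 2 + copies 3 (K 1))) \/
  isomorphic G (K 3 \vee (K 1 + Kbip 1 4)) \/
  isomorphic G (K 3 \vee (K 2 + Kbip 1 3)) \/
  isomorphic G ((K 2 \vee copies 2 (K 1)) \vee copies 5 (K 1)) \/
  isomorphic G (K 4 \vee copies 5 (K 1)) \/
  isomorphic G (Kbip 1 2 \vee copies 4 (K 1)) \/
  isomorphic G (K 2 \vee (K 1 + Kbip 1 3)) \/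
  isomorphic G (K 3 \vee copies 4 (K 1)).

(* Main.v *)
Require Import Defs.
From mathcomp Require Import all_boot.
From mathcomp Require Import zify.

(** If [G] is hamiltonian, averaging over a Hamilton cycle gives two consecutive
    vertices of degree sum at least [n + 1], because [4 m > n^2] (this reduces to
    [n^2 - 10 n + 28 > 0]); by Bondy's argument [G] is then pancyclic.

    If [G] is not hamiltonian, adding an edge between nonadjacent vertices of
    degree sum at least [n] keeps it so (Ore), hence we may assume that there are
    none.  A nonadjacent pair [u, v] of maximal degree sum, [deg u <= deg v]
    and [k := deg u], gives [k] vertices of degree at most [k] and [n - k] of
    degree at most [n - k - 1], so [m <= binomial (n - k) 2 + k^2].  This exceeds
    the assumed bound by only [(k - 2) (3 k + 7 - 2 n) / 2 <= 1], which leaves no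
    room for an edge outside [K_k \/ (K_(n-2k) + k K_1)].  So [G] is that graph,
    or, for [n = 2 k + 1] with [k = 3, 4], that graph minus at most one edge. *)

Set Implicit Arguments.
Unset Strict Implicit.
Unset Printing Implicit Defensive.

(** * Cycles assembled from two paths *)

(** The first path is run forwards and the second backwards, so the two closing edges join end to
    end and start to start. *)
Lemma ucycle_cat_rev (T : eqType) (e : rel T) (x y : T) (s1 s2 : seq T) :
    symmetric e -> path e x s1 -> path e y s2 -> uniq ((x :: s1) ++ (y :: s2)) ->
    e (last x s1) (last y s2) -> e y x ->
  ucycle e ((x :: s1) ++ rev (y :: s2)).
Proof.
move=> sym_e p1 p2 u12 e1 e2; apply/andP; split; last first.
  by rewrite (perm_uniq (_ : perm_eq _ ((x :: s1) ++ (y :: s2)))) // perm_cat2l perm_rev.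
rewrite (lastI y s2) rev_rcons /= rcons_cat cat_path p1 /= e1 rcons_path.
rewrite rev_path (eq_path (e' := e)) ?p2 /=; last by move=> a b; rewrite sym_e.
case: s2 {p2 u12 e1} => [|z s2] //=.
by rewrite rev_cons last_rcons.
Qed.

Lemma path_iota (r : rel nat) (i m : nat) :
  (forall k, i <= k < i + m -> r k k.+1) -> path r i (iota i.+1 m).
Proof.
elim: m i => //= m IHm i r_step; rewrite r_step ?IHm //; last by lia.
by move=> k k_range; apply: r_step; lia.
Qed.

Lemma last_iota (i m : nat) : last i (iota i.+1 m) = i + m.
Proof. by elim: m i => [|m IHm] i /=; rewrite ?addn0 // IHm addSnnS. Qed.

(** Cycles through the vertices of a path can thus be built as lists of positions, where the side
    conditions are arithmetic. *)
Lemma ucycle_map_nth (T : eqType) (e : rel T) (x0 : T) (p : seq T) (c : seq nat) :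
    uniq p -> (forall i, i \in c -> i < size p) ->
    ucycle (relpre (nth x0 p) e) c ->
  ucycle e [seq nth x0 p i | i <- c].
Proof.
move=> up ltc /andP[ec uc]; rewrite /ucycle cycle_map ec map_inj_in_uniq // => i j ci cj.
by move/eqP; rewrite nth_uniq ?ltc // => /eqP.
Qed.

(** * Degrees, Hamilton cycles and Ore's condition *)

Section Relations.
Variable T : finType.
Implicit Types (e : rel T) (s : seq T).

(** Bare relations are used here because the closure argument varies the edge set over a fixed
    vertex type. *)
Definition deg e (x : T) : nat := #|[set y | e x y]|.

Definition hamiltonian e : Prop := exists c : seq T, ucycle e c /\ size c = #|T|.

(** The indices sent by [f] into [A] number at least [#|A|], those sent by [g] into [B] at least
    [#|B|]; among [k] indices the two sets must meet. *)
Lemma pigeonhole_pair (k : nat) (f g : nat -> T) (A B : {set T}) :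
    (forall x, x \in A -> exists2 i, i < k & x = f i) ->
    (forall x, x \in B -> exists2 i, i < k & x = g i) ->
    k < #|A| + #|B| ->
  exists i, [/\ i < k, f i \in A & g i \in B].
Proof.
move=> fA gB ltk.
pose P := [set i : 'I_k | f i \in A]; pose Q := [set i : 'I_k | g i \in B].
have leA : #|A| <= #|P|.
  apply: leq_trans (leq_imset_card (fun i : 'I_k => f i) P).
  apply/subset_leq_card/subsetP => x Ax; have [i lti xE] := fA x Ax.
  by apply/imsetP; exists (Ordinal lti); rewrite // inE /= -xE.
have leB : #|B| <= #|Q|.
  apply: leq_trans (leq_imset_card (fun i : 'I_k => g i) Q).
  apply/subset_leq_card/subsetP => x Bx; have [i lti xE] := gB x Bx.
  by apply/imsetP; exists (Ordinal lti); rewrite // inE /= -xE.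
have : 0 < #|P :&: Q|.
  by have := cardsUI P Q; have := max_card (P :|: Q); rewrite card_ord; lia.
by case/card_gt0P=> i; rewrite !inE => /andP[Pi Qi]; exists i; rewrite ltn_ord.
Qed.

(** Cutting the cycle at a chosen edge leaves a path whose two ends are the ends of that edge. *)
Lemma cycle_edge_split e (x y : T) c :
  symmetric e -> ucycle e c -> x \in c -> next c x = y ->
  exists s, [/\ path e y s, uniq (y :: s), last y s = x, size c = (size s).+1
     & e x y].
Proof.
move=> sym_e /andP[ec uc] xc nx.
have yc : y \in c by rewrite -nx mem_next.
have exy : e x y by rewrite -nx; apply: next_cycle.
case: (rot_to yc) => i s cE; exists s.
have : cycle e (y :: s) by rewrite -cE rot_cycle.
have uys : uniq (y :: s) by rewrite -cE rot_uniq.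
rewrite /= rcons_path => /andP[ps els].
split=> //; last by rewrite -(size_rot i c) cE.
have : prev (rot i c) y = x by rewrite prev_rot // -nx prev_next.
rewrite cE prev_nth mem_head /=; case/andP: uys => /memNindex -> _.
by rewrite -[size s]/(size (y :: s)).-1 nth_last.
Qed.

Lemma mem_spanning (x : T) s : uniq s -> size s = #|T| -> x \in s.
Proof.
move=> /card_uniqP us sE; have sT : #|s| = #|T| by rewrite us.
by have/(subset_cardP sT) -> : s \subset T by apply/subsetP.
Qed.

Lemma index_spanning (x : T) s : uniq s -> size s = #|T| -> index x s < size s.
Proof. by move=> us sE; rewrite index_mem mem_spanning. Qed.

Lemma hamiltonian_of_path e (x : T) s :
    symmetric e -> irreflexive e -> path e x s -> uniq (x :: s) ->
    size (x :: s) = #|T| -> #|T| <= deg e x + deg e (last x s) ->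
  hamiltonian e.
Proof.
move=> sym_e irr_e ps us sE le_deg; pose p := x :: s; pose k := size s.
have pk : nth x p k = last x s by rewrite -[k]/(size p).-1 nth_last.
(* With v_0 .. v_k the path, a position i is sought such that v_0 is adjacent to v_(i+1) and v_k to
   v_i. There are only n - 1 positions, and the two degrees sum to at least n. *)
have [] := @pigeonhole_pair k (fun i => nth x p i.+1) (fun i => nth x p i)
  [set y | e x y] [set y | e (last x s) y].
- move=> y; rewrite inE => exy; have lty := index_spanning y us sE.
  have yp := mem_spanning y us sE.
  have yx : x == y = false by apply: contraTF exy => /eqP ->; rewrite irr_e.
  exists (index y s); last by rewrite /= nth_index //; move: yp; rewrite inE eq_sym yx.
  by move: lty; rewrite /= yx ltnS.
- move=> y; rewrite inE => exy; have lty := index_spanning y us sE.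
  have yp := mem_spanning y us sE.
  exists (index y p); last by rewrite nth_index.
  rewrite ltn_neqAle -ltnS lty andbT; apply: contraTneq exy => yk.
  by rewrite -pk -yk nth_index // irr_e.
- by move: le_deg; rewrite -sE.
move=> i []; rewrite !inE => ltik exi eli.
have si : s = take i s ++ nth x s i :: drop i.+1 s.
  by rewrite -drop_nth // cat_take_drop.
move: ps us; rewrite si cat_path -cat_cons => /andP[p1 /= /andP[_ p2]] us.
(* The cycle is v_0 .. v_i followed by v_k down to v_(i+1), closed by the two crossing edges. *)
exists ((x :: take i s) ++ rev (nth x s i :: drop i.+1 s)); split; last first.
  by rewrite size_cat size_rev -size_cat cat_cons -si.
apply: ucycle_cat_rev => //; last by rewrite sym_e.
rewrite sym_e; move: eli; rewrite {1}si last_cat /=; congr (e _ _).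
by rewrite (last_nth x) size_take ltik /p; case: i {si p1 p2 us exi} ltik => //= i ltik;
   rewrite nth_take.
Qed.

Definition add_edge e (u v : T) : rel T :=
  fun x y => [|| e x y, (x == u) && (y == v) | (x == v) && (y == u)].

Lemma add_edge_sym e u v : symmetric e -> symmetric (add_edge e u v).
Proof.
move=> sym_e x y; rewrite /add_edge sym_e; congr (_ || _).
by rewrite orbC (andbC (x == v)) (andbC (x == u)).
Qed.

(** A Hamilton cycle through the new edge becomes, once cut there, a Hamilton path of [e] between
    [u] and [v], to which [hamiltonian_of_path] applies. *)
Lemma hamiltonian_add_edge e (u v : T) :
    symmetric e -> irreflexive e -> 2 < #|T| -> #|T| <= deg e u + deg e v ->
  hamiltonian (add_edge e u v) -> hamiltonian e.
Proof.
move=> sym_e irr_e T_gt2 le_deg [c [cyc_c cE]].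
have uc : uniq c by case/andP: cyc_c.
have [all_e|] := boolP [forall x, e x (next c x)].
  exists c; split=> //; apply/andP; split=> //.
  by apply: cycle_from_next => // x _; apply: (forallP all_e).
rewrite negb_forall => /existsP[x nex].
have [s [ps us lasts cs exy]] :=
  cycle_edge_split (add_edge_sym u v sym_e) cyc_c (mem_spanning x uc cE) erefl.
set y := next c x in nex ps us lasts exy.
have xy_uv : (x == u) && (y == v) || (x == v) && (y == u).
  by move: exy; rewrite /add_edge (negbTE nex).
apply: (hamiltonian_of_path (x := y) (s := s)); rewrite ?lasts //=; last 2 first.
- by rewrite -cs cE.
- by case/orP: xy_uv => /andP[/eqP -> /eqP ->]; rewrite // addnC.
apply/(pathP y) => i lti; have /(pathP y)/(_ i lti) := ps.
have pk : nth y (y :: s) (size s) = x.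
  by rewrite -[size s]/(size (y :: s)).-1 nth_last /=.
case/orP=> // contra; exfalso.
(* The path cannot use the new edge again: its ends [y] and [x] would then be consecutive on it,
   which for distinct vertices forces [#|T|] to be 2. *)
have [[iE jE]|[iE jE]] : (nth y (y :: s) i = x /\ nth y (y :: s) i.+1 = y) \/
       (nth y (y :: s) i = y /\ nth y (y :: s) i.+1 = x).
  case/orP: xy_uv contra => /andP[/eqP <- /eqP <-].
    by case/orP=> /andP[/eqP iE /eqP jE]; auto.
  by case/orP=> /andP[/eqP iE /eqP jE]; auto.
- have := @nth_uniq _ y (y :: s) i.+1 0 lti isT us.
  by rewrite jE /= eqxx.
- have := @nth_uniq _ y (y :: s) i 0 (ltnW lti) isT us.
  have := @nth_uniq _ y (y :: s) i.+1 (size s) lti (ltnSn _) us.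
  rewrite iE jE pk /= !eqxx; move: T_gt2; rewrite -cE cs.
  by move: (size s) => m; clear; lia.
Qed.

Lemma hamiltonian_complete e :
  2 < #|T| -> (forall x y, x != y -> e x y) -> hamiltonian e.
Proof.
move=> T_gt2 all_e; exists (enum T); split; last by rewrite -cardE.
apply/andP; split; last exact: enum_uniq.
case: (enum T) (enum_uniq T) (cardE T) => [|x s] us sE.
  by move: T_gt2; rewrite sE.
rewrite /= rcons_path; apply/andP; split.
  move: us; rewrite uniq_pairwise => /pairwise_sorted.
  by apply: sub_path => a b; apply: all_e.
apply: all_e; case: s us sE => [|y s] us sE; first by move: T_gt2; rewrite sE.
by case/andP: us => nx _ /=; apply: contraNneq nx => <-; exact: mem_last.
Qed.

(** * Cycles of every length from a Hamilton cycle *)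

(* The cycle of length [l] closes up a segment of the hamiltonian path
   [v_0 .. v_(n-1)] between a neighbour [v_i] of [v_0] and a neighbour [v_j] of
   [v_(n-1)]; [i |-> j] is a bijection of [1 .. n-2], so some [i] works. *)
Lemma cycle_of_degree_sum e (x : T) s (l : nat) :
    symmetric e -> irreflexive e -> path e x s -> uniq (x :: s) ->
    size (x :: s) = #|T| -> e (last x s) x ->
    #|T| < deg e x + deg e (last x s) -> 2 < l <= #|T| ->
  exists c, ucycle e c /\ size c = l.
Proof.
move=> sym_e irr_e ps us sE elx lt_deg /andP[l_gt2 le_l].
set n := #|T| in sE lt_deg le_l; set y := last x s in elx lt_deg; pose p := x :: s.
(* The value of [j] makes the cycle have length [l]: v_0, v_i .. v_j, v_(n-1) has j - i + 3
   vertices, and v_0 .. v_j, v_(n-1) .. v_i has j + 1 + n - i. The second form takes over when the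
   first would need j > n - 2. *)
pose j i := if i + l <= n + 1 then i + l - 3 else i + l - n - 1.
have nk : n = (size s).+1 by [].
have pk : nth x p (size s) = y by rewrite -[size s]/(size p).-1 nth_last.
have in_range z : z != x -> z != y -> exists2 i, i < n - 2 & z = nth x p i.+1.
  move=> zx zy; have := index_spanning z us sE; have := mem_spanning z us sE.
  rewrite -/p => zp ltz; have zE := nth_index x zp.
  have i0 : index z p <> 0 by move=> i0; move: zx; rewrite -zE i0 eqxx.
  have ik : index z p <> size s by move=> ik; move: zy; rewrite -zE ik pk eqxx.
  exists (index z p).-1; last by rewrite prednK //; lia.
  by move: ltz; rewrite [size _]/= nk; lia.
have [] := @pigeonhole_pair (n - 2) (fun i => nth x p i.+1)
    (fun i => nth x p (j i.+1)) ([set z | e x z] :\ y) ([set z | e y z] :\ x).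
- move=> z; rewrite !inE => /andP[zy exz]; apply: in_range => //.
  by apply: contraTneq exz => ->; rewrite irr_e.
- move=> z; rewrite !inE => /andP[zx eyz].
  have [|i lti ->] := in_range z zx; first by apply: contraTneq eyz => ->; rewrite irr_e.
  (* This is the inverse of [j] at position [i.+1], lowered by one because the pigeonhole indices
     start at 0. *)
  exists (if l - 2 <= i.+1 then i.+1 + 2 - l else i.+1 + n - l).
    by case: ifP; lia.
  congr nth; rewrite /j.
  by case: (boolP (l - 2 <= i.+1)) => h; case: ifP; lia.
(* The edge between [x] and [y] is discarded at both ends; the remaining degree sum is at least n -
   1, still more than the n - 2 positions. *)
- have exy : e x y by rewrite sym_e.
  have := cardsD1 y [set z | e x z]; have := cardsD1 x [set z | e y z].
  by rewrite !inE exy elx; move: lt_deg; rewrite /deg; lia.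
move=> i0 []; rewrite !inE; set i := i0.+1 => lti0 /andP[iy exi] /andP[jx eyj].
have {lti0} lti : 0 < i < n.-1 by rewrite /i; lia.
clearbody i.
have step k : k < size s -> e (nth x p k) (nth x p k.+1).
  by move=> ltk; have/(pathP x)/(_ k ltk) := ps.
rewrite {}/j in jx eyj; case: ifP jx eyj => h; set j := (X in nth x p X) => jx eyj.
- have jE : j + 3 = i + l by rewrite /j; lia.
  exists [seq nth x p k | k <- (i :: iota i.+1 (j - i)) ++ rev (0 :: [:: size s])].
  split; last by rewrite size_map size_cat size_rev /= size_iota; lia.
  apply: ucycle_map_nth => //.
    move=> k; rewrite mem_cat mem_rev -[i :: _]/(iota i (j - i).+1) mem_iota !inE.
    by rewrite (_ : size p = n) //; lia.
  apply: ucycle_cat_rev; rewrite ?last_iota /= ?pk //.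
  + by move=> a b; exact: sym_e.
  + by apply: path_iota => k k_range /=; apply: step; lia.
  + by rewrite sym_e elx.
  + rewrite mem_cat mem_iota cat_uniq iota_uniq /= !mem_iota !inE /=; lia.
  + by rewrite subnKC 1?sym_e //; lia.
- have jE : j + n + 1 = i + l by rewrite /j; lia.
  exists [seq nth x p k | k <- (0 :: iota 1 j) ++ rev (i :: iota i.+1 (n.-1 - i))].
  split; last by rewrite size_map size_cat size_rev /= !size_iota; lia.
  apply: ucycle_map_nth => //.
    move=> k; rewrite mem_cat mem_rev -[i :: _]/(iota i (n.-1 - i).+1) mem_iota.
    by rewrite -[0 :: _]/(iota 0 j.+1) mem_iota (_ : size p = n) //; lia.
  apply: ucycle_cat_rev; rewrite ?last_iota.
  + by move=> a b; exact: sym_e.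
  + by apply: path_iota => k k_range /=; apply: step; lia.
  + by apply: path_iota => k k_range /=; apply: step; lia.
  + rewrite -[i :: _]/(iota i (n.-1 - i).+1) -[0 :: _]/(iota 0 j.+1) cat_uniq !iota_uniq.
    by rewrite andbT; apply/hasPn => k; rewrite !mem_iota; lia.
  + have -> : i + (n.-1 - i) = size s by lia.
    by rewrite /= pk sym_e.
  + by rewrite /= sym_e.
Qed.

Lemma sum_next (F : T -> nat) c :
  uniq c -> size c = #|T| -> \sum_x F (next c x) = \sum_x F x.
Proof.
move=> uc cE; rewrite [RHS](reindex_inj (can_inj (prev_next uc))) //.
Qed.

(** [next c] permutes the vertices, so the degree sums along the cycle edges total twice the sum of
    all degrees, and their average exceeds n. *)
Lemma cycles_of_hamiltonian e (l : nat) :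
    symmetric e -> irreflexive e -> hamiltonian e ->
    #|T| * #|T| < 2 * (\sum_x deg e x) -> 2 < l <= #|T| ->
  exists c, ucycle e c /\ size c = l.
Proof.
move=> sym_e irr_e [c [cyc_c cE]] lt_deg l_range.
have uc : uniq c by case/andP: cyc_c.
have [/existsP[x lt_x]|] := boolP [exists x, #|T| < deg e x + deg e (next c x)].
  have [s [ps us lasts cs exy]] :=
    cycle_edge_split sym_e cyc_c (mem_spanning x uc cE) erefl.
  apply: (cycle_of_degree_sum (x := next c x) (s := s)); rewrite ?lasts //=.
    by rewrite -cs cE.
  by rewrite addnC.
rewrite negb_exists => /forallP le_x; exfalso.
have : \sum_x (deg e x + deg e (next c x)) <= \sum_(x : T) #|T|.
  by apply: leq_sum => x _; rewrite leqNgt.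
rewrite big_split /= sum_next // sum_nat_const addnn -mul2n.
by rewrite leqNgt lt_deg.
Qed.

(** * Structure of a non-hamiltonian graph *)

Lemma card_nonneighbours e (x : T) :
  irreflexive e -> #|[set y | (y != x) && ~~ e x y]| + deg e x = #|T|.-1.
Proof.
move=> irr_e; rewrite -(cardsC1 x) -(cardsID [set y | e x y] [set~ x]) addnC.
congr (_ + _); apply: eq_card => y; rewrite !inE; last by rewrite andbC.
by case: eqVneq => // ->; rewrite irr_e.
Qed.

(** Serves by contradiction: slack [k] at a single vertex (or, in the next lemma, shared by two)
    survives summation. *)
Lemma leq_sum_gain (F G : T -> nat) (x : T) (k : nat) :
  (forall y, F y <= G y) -> F x + k <= G x -> \sum_y F y + k <= \sum_y G y.
Proof.
move=> leFG le_x; rewrite (bigD1 x) // [leqRHS](bigD1 x) //= addnAC.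
by apply: leq_add => //; apply: leq_sum.
Qed.

Lemma leq_sum_gain2 (F G : T -> nat) (x z : T) (k : nat) :
    (forall y, F y <= G y) -> x != z -> F x + F z + k <= G x + G z ->
  \sum_y F y + k <= \sum_y G y.
Proof.
move=> leFG neq_xz le_xz; rewrite (bigD1 x) // [leqRHS](bigD1 x) //=.
rewrite (bigD1 z) 1?eq_sym // [X in _ <= _ + X](bigD1 z) 1?eq_sym //=.
rewrite !addnA addnAC; apply: leq_add => //; exact: leq_sum.
Qed.

(* [G] is a spanning subgraph of [K_k \/ (K_(n-2k) + k K_1)], with [C] and [I]
   the vertex sets of [K_k] and of [k K_1]. *)
Definition separated e (C I : {set T}) (k : nat) : Prop :=
  [/\ #|C| = k, #|I| = k, [disjoint C & I], (1 < k) && (2 * k < #|T|) &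
      forall x y, x \in I -> e x y -> y \in C].

Lemma sum_mem (A : {set T}) : \sum_(x : T) (x \in A) = #|A|.
Proof. by rewrite -sum1_card [RHS]big_mkcond; apply: eq_bigr => x _; case: (x \in A). Qed.

Lemma sum_indicator (a b : nat) (A : {set T}) :
  \sum_(x : T) (a + b * (x \in A)) = #|T| * a + b * #|A|.
Proof. by rewrite big_split /= sum_nat_const -big_distrr /= sum_mem. Qed.

Lemma separated_of_ore e :
    symmetric e -> irreflexive e -> 5 <= #|T| -> ~ hamiltonian e ->
    (forall x, 2 <= deg e x) ->
    (#|T| - 2) * (#|T| - 3) + 8 <= \sum_x deg e x ->
    (forall x y, x != y -> ~~ e x y -> deg e x + deg e y < #|T|) ->
  exists C I k, separated e C I k.
Proof.
move=> sym_e irr_e n_ge5 nham deg_ge2 sum_ge ore.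
pose nonadj := [pred p : T * T | (p.1 != p.2) && ~~ e p.1 p.2].
have [p0 p0_nonadj] : exists p, nonadj p.
  apply/existsP; apply: contra_notT nham; rewrite negb_exists => /forallP all_e.
  apply: hamiltonian_complete; first by lia.
  by move=> x y neq_xy; have := all_e (x, y); rewrite /= neq_xy negbK.
case: (arg_maxnP (fun p => deg e p.1 + deg e p.2) p0_nonadj) => -[u0 v0] /= uv0 max0.
have [u [v [neq_uv nuv le_uv max_uv]]] : exists u v, [/\ u != v, ~~ e u v,
    deg e u <= deg e v &
    forall x y, x != y -> ~~ e x y -> deg e x + deg e y <= deg e u + deg e v].
  have max1 x y : x != y -> ~~ e x y -> deg e x + deg e y <= deg e u0 + deg e v0.
    by move=> neq_xy nxy; apply: (max0 (x, y)); rewrite /= neq_xy.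
  case/andP: uv0 => neq_uv nuv; case: (leqP (deg e u0) (deg e v0)) => le_uv.
    by exists u0, v0.
  exists v0, u0; rewrite eq_sym sym_e; split=> //; first exact: ltnW.
  by move=> x y; rewrite addnC (addnC (deg e v0)) eq_sym sym_e; exact: max1.
have lt_n := ore u v neq_uv nuv; have k_ge2 := deg_ge2 u.
set n := #|T| in n_ge5 sum_ge ore lt_n *; pose C := [set y | e u y].
have CE : #|C| = deg e u by [].
set k := deg e u in le_uv max_uv lt_n k_ge2 CE.
have lt_k : 2 * k < n by lia.
(* [v] has n - 1 - deg v nonneighbours other than itself, at least [k] because deg u + deg v < n. *)
have [s [us sk sU]] : exists s : seq T, [/\ uniq s, size s = k &
    {subset s <= [set y | (y != v) && ~~ e v y]}].
  by apply/card_geqP; have := card_nonneighbours v irr_e; rewrite -/n; lia.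
pose I := [set x in s].
have IE : #|I| = k by rewrite cardsE (card_uniqP us).
have degI x : x \in I -> deg e x <= k.
  rewrite inE => /sU; rewrite inE => /andP[neq_xv nvx].
  by have := max_uv x v neq_xv; rewrite sym_e => /(_ nvx); lia.
have deg_lt x : deg e x <= n.-1.
  by rewrite -(card_nonneighbours x irr_e) leq_addl.
have degW x : x \notin C -> deg e x <= n - k - 1.
  rewrite inE => nux; have [->|neq_xu] := eqVneq x u; first by rewrite -/k; lia.
  have := max_uv u x; rewrite eq_sym neq_xu nux -/k => /(_ isT isT).
  by move: lt_n; clearbody n k; clear; lia.
(* [F <= g] packs three degree bounds into one: [k] on [I], n - k - 1 outside [C], and n - 1 on [C].
   Equality holds everywhere in K_k \/ (K_(n-2k) + k K_1). *)
pose F x := deg e x + (n - 2 * k - 1) * (x \in I).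
pose g x := (n - k - 1) + k * (x \in C).
have leFg x : F x <= g x.
  rewrite /F /g; have := degI x; have := degW x; have := deg_lt x.
  case: (x \in I) => /=; case: (x \in C) => /=; rewrite ?muln1 ?muln0 ?addn0.
  - by move=> _ _ /(_ isT); lia.
  - by move=> _ _ /(_ isT); lia.
  - by lia.
  - by move=> _ /(_ isT); lia.
(* The total slack is at most (k - 2)(3k + 7 - 2n), which is 0 for k = 2 and at most 2 otherwise,
   hence always below [k]. *)
have no_gain : ~ (\sum_x F x + k <= \sum_x g x).
  rewrite sum_indicator CE big_split /= -big_distrr /= sum_mem IE.
  rewrite -/n; move: sum_ge; set S := \sum_x _.
  (* Writing n as 2k + 1 + t removes the truncated subtractions. *)
  have [t nE] : exists t, n = 2 * k + 1 + t by exists (n - (2 * k + 1)); lia.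
  have -> : n - 2 * k - 1 = t by lia.
  have -> : n - k - 1 = k + t by lia.
  have -> : n - 2 = 2 * k + t - 1 by lia.
  have -> : n - 3 = 2 * k + t - 2 by lia.
  rewrite {}nE.
  case: k k_ge2 {CE lt_k le_uv max_uv lt_n sk IE degI degW F g leFg}
    => [|[|[|r]]] // _.
    by lia.
  have -> : 2 * r.+3 + t - 1 = 2 * r + 5 + t by lia.
  have -> : 2 * r.+3 + t - 2 = 2 * r + 4 + t by lia.
  by nia.
(* At a common vertex [F] is at most n - k - 1 while [g] is n - 1, a forbidden slack of [k]. *)
have disjCI : [disjoint C & I].
  rewrite disjoint_sym; apply/pred0P => x /=; apply/negP => /andP[Ix Cx]; apply: no_gain.
  apply: (leq_sum_gain (x := x)) => //.
  rewrite /F /g Ix Cx !muln1.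
  by move: (degI x Ix) lt_k; clearbody n k; clear; lia.
exists C, I, k; split=> // [|x y Ix exy]; first by rewrite k_ge2.
have nCx : x \notin C by rewrite (disjointFl disjCI).
apply: contra_notT no_gain => nCy.
(* [x] has at most [k] neighbours and one of them lies outside [C], so it misses some [c] in [C]. By
   [ore], deg x + deg c < n, which leaves slack [k] on the pair. *)
have [c Cc nxc] : exists2 c, c \in C & ~~ e x c.
  have : ~~ (y |: C \subset [set z | e x z]).
    apply/negP => /subset_leq_card; rewrite cardsU1 nCy CE.
    by rewrite add1n ltnNge degI.
  case/subsetPn => c; rewrite in_setU1 inE => /orP[/eqP -> |Cc] nxc; last by exists c.
  by rewrite exy in nxc.
have neq_xc : x != c by apply: contraNneq nCx => ->.
apply: (leq_sum_gain2 (x := x) (z := c)) => //.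
rewrite /F /g Ix (negbTE nCx) Cc (disjointFr disjCI Cc) !muln1 !muln0 !addn0.
by move: (ore x c neq_xc nxc) lt_k; clearbody n k; clear; lia.
Qed.

(** Closure argument: edges are added between nonadjacent vertices of degree sum at least n until
    Ore's bound leaves none, by induction on the number of nonadjacent pairs. The hypotheses persist
    upwards, and [separated] passes back down because it only forbids edges. *)
Lemma separated_of_not_hamiltonian e :
    symmetric e -> irreflexive e -> 5 <= #|T| -> ~ hamiltonian e ->
    (forall x, 2 <= deg e x) ->
    (#|T| - 2) * (#|T| - 3) + 8 <= \sum_x deg e x ->
  exists C I k, separated e C I k.
Proof.
have [m] := ubnP #|[set p : T * T | ~~ e p.1 p.2]|.
elim: m e => // m IHm e lt_m sym_e irr_e n_ge5 nham deg_ge2 sum_ge.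
have [|] := boolP [exists u, exists v,
    [&& u != v, ~~ e u v & #|T| <= deg e u + deg e v]]; last first.
  rewrite negb_exists => /forallP noore; apply: separated_of_ore => // x y neq_xy nxy.
  rewrite ltnNge; have := noore x; rewrite negb_exists => /forallP/(_ y).
  by rewrite neq_xy nxy.
case/existsP=> u /existsP[v /and3P[neq_uv nuv le_n]].
have sub_e x y : e x y -> add_edge e u v x y by rewrite /add_edge => ->.
have le_deg x : deg e x <= deg (add_edge e u v) x.
  by apply/subset_leq_card/subsetP => y; rewrite !inE; exact: sub_e.
have [|||||||C [I [k [? ? ? ? sep]]]] := IHm (add_edge e u v).
- rewrite -ltnS; apply: leq_trans lt_m; rewrite ltnS; apply/proper_card/properP; split.
    by apply/subsetP => p; rewrite !inE; apply: contra; exact: sub_e.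
  by exists (u, v); rewrite inE //= negbK /add_edge !eqxx orbT.
- exact: add_edge_sym.
- move=> x; rewrite /add_edge irr_e /=; apply/negbTE; move: neq_uv.
  by apply: contra => /orP[]/andP[/eqP <- /eqP <-].
- by [].
- by move/(hamiltonian_add_edge sym_e irr_e _ le_n) => ham; apply/nham/ham; lia.
- by move=> x; apply: leq_trans (le_deg x).
- by apply: leq_trans sum_ge _; apply: leq_sum.
by exists C, I, k; split=> // x y Ix /sub_e; exact: sep.
Qed.

(** * Counting the edges missing from the extremal graph *)

Lemma sum_deg_pairs e : \sum_x deg e x = #|[set p : T * T | e p.1 p.2]|.
Proof.
rewrite -sum1_card (eq_bigl (fun p => e p.1 p.2)); last by move=> p; rewrite inE.
rewrite -(pair_big_dep xpredT e (fun _ _ => 1)) /=.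
by apply: eq_bigr => x _; rewrite /deg -sum1_card; apply: eq_bigl => y; rewrite inE.
Qed.

(** Adjacency of K_k \/ (K_(n-2k) + k K_1) when [C] and [I] are as in [separated]. *)
Definition separated_adj (C I : {set T}) : rel T :=
  fun x y => (x != y) && [|| x \in C, y \in C | (x \notin I) && (y \notin I)].

Lemma separated_adjC C I : symmetric (separated_adj C I).
Proof. by move=> x y; rewrite /separated_adj eq_sym orbCA (andbC (x \notin I)). Qed.

Lemma sub_separated_adj e C I k x y :
  symmetric e -> irreflexive e -> separated e C I k -> e x y -> separated_adj C I x y.
Proof.
move=> sym_e irr_e [_ _ _ _ sep] exy; rewrite /separated_adj; apply/andP; split.
  by apply: contraTneq exy => ->; rewrite irr_e.
have [Ix|nIx] := boolP (x \in I); first by rewrite (sep x y Ix exy) orbT.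
have [Iy|nIy] := boolP (y \in I); last by rewrite !orbT.
by rewrite (sep y x Iy) // sym_e.
Qed.

Lemma sum_deg_separated_adj e C I k :
    separated e C I k ->
  \sum_x deg (separated_adj C I) x = 2 * (k * k) + (#|T| - k) * (#|T| - k - 1).
Proof.
case=> CE IE disjCI /andP[k_ge2 lt_k] _; set n := #|T| in lt_k *.
(* One equation for the three degrees: n - 1 on [C], [k] on [I], n - k - 1 elsewhere. *)
have degE x : deg (separated_adj C I) x + (n - 2 * k - 1) * (x \in I) =
    (n - k - 1) + k * (x \in C).
  have [Cx|nCx] := boolP (x \in C).
    rewrite (disjointFr disjCI Cx) /deg (_ : [set y | _] = [set~ x]); last first.
      by apply/setP => y; rewrite !inE /separated_adj Cx andbT eq_sym.
    by rewrite cardsC1 -/n; lia.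
  have [Ix|nIx] := boolP (x \in I).
    rewrite /deg (_ : [set y | _] = C); first by rewrite CE; lia.
    apply/setP => y; rewrite !inE /separated_adj (negbTE nCx) Ix /= orbF.
    by case: eqVneq => // <-; rewrite (negbTE nCx).
  rewrite /deg (_ : [set y | _] = ~: I :\ x).
    by have := cardsD1 x (~: I); have := cardsC I; rewrite inE nIx IE -/n; lia.
  apply/setP => y; rewrite !inE /separated_adj (negbTE nCx) nIx eq_sym /=; congr (_ && _).
  by case Cy: (y \in C); rewrite // (disjointFr disjCI Cy).
have : \sum_x (deg (separated_adj C I) x + (n - 2 * k - 1) * (x \in I)) =
    \sum_x (n - k - 1 + k * (x \in C)) by apply: eq_bigr => x _; exact: degE.
rewrite sum_indicator big_split /= -big_distrr /= sum_mem CE IE -/n.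
have [t nE] : exists t, n = 2 * k + 1 + t by exists (n - (2 * k + 1)); lia.
have -> : n - 2 * k - 1 = t by lia.
have -> : n - k - 1 = k + t by lia.
have -> : n - k = k + t + 1 by lia.
by rewrite nE; lia.
Qed.

(** Pairs are ordered, so a missing edge of a symmetric relation counts twice and the bound 2 means
    at most one missing edge. *)
Definition missing e (C I : {set T}) : {set T * T} :=
  [set p | separated_adj C I p.1 p.2 && ~~ e p.1 p.2].

Lemma sum_deg_missing e C I k :
    symmetric e -> irreflexive e -> separated e C I k ->
  \sum_x deg e x + #|missing e C I| = 2 * (k * k) + (#|T| - k) * (#|T| - k - 1).
Proof.
move=> sym_e irr_e sep; rewrite -(sum_deg_separated_adj sep) !sum_deg_pairs.
rewrite -[RHS](cardsID [set p | e p.1 p.2]); congr (_ + _); apply: eq_card => p.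
  by rewrite !inE andbC; case ep: (e _ _) => //=; rewrite (sub_separated_adj _ _ sep).
by rewrite !inE andbC.
Qed.

(** With n = 2k + 1 + t, the edge bound says that [missing] has at most (k - 2)(5 - k - 2t)
    elements; this is 0 for k = 2 and negative for k > 5, and k = 3, 4, 5 leave few values of t. *)
Lemma separated_parameters e C I k :
    symmetric e -> irreflexive e -> separated e C I k ->
    (#|T| - 2) * (#|T| - 3) + 8 <= \sum_x deg e x ->
  [\/ k = 2 /\ #|missing e C I| = 0,
      [/\ k = 3, #|T| = 8 & #|missing e C I| = 0],
      [/\ k = 5, #|T| = 11 & #|missing e C I| = 0] |
      [/\ k = 3 \/ k = 4, #|T| = 2 * k + 1 & #|missing e C I| <= 2]].
Proof.
move=> sym_e irr_e sep; have := sum_deg_missing sym_e irr_e sep.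
case: sep => _ _ _ /andP[k_ge2 lt_k] _; move: lt_k.
move: (\sum_x _) #|missing _ _ _| #|T| => S M n lt_k sumE sum_ge.
have [t nE] : exists t, n = 2 * k + 1 + t by exists (n - (2 * k + 1)); lia.
rewrite (_ : n - k - 1 = k + t) in sumE; last by lia.
rewrite (_ : n - k = k + t + 1) in sumE; last by lia.
rewrite {lt_k}nE in sum_ge *.
case: k k_ge2 sumE sum_ge => [|[|[|[|[|[|r]]]]]] // _ sumE.
- by move=> sum_ge; constructor 1; split=> //; nia.
- rewrite (_ : _ - 2 = t + 5) 1?(_ : _ - 3 = t + 4); [|by lia..] => sum_ge.
  have : 2 * t + M <= 2 by nia.
  case: t {sumE sum_ge} => [|t] le2; first by constructor 4; split; [left| |]; lia.
  by constructor 2; split; lia.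
- rewrite (_ : _ - 2 = t + 7) 1?(_ : _ - 3 = t + 6); [|by lia..] => sum_ge.
  have le2 : 4 * t + M <= 2 by nia.
  by constructor 4; split; [right| |]; lia.
- rewrite (_ : _ - 2 = t + 9) 1?(_ : _ - 3 = t + 8); [|by lia..] => sum_ge.
  have le0 : 6 * t + M <= 0 by nia.
  by constructor 3; split; lia.
rewrite (_ : _ - 2 = 2 * r + 11 + t) 1?(_ : _ - 3 = 2 * r + 10 + t); [|by lia..].
by move=> sum_ge; exfalso; nia.
Qed.

End Relations.

(** * Isomorphisms from vertex labels *)

(** Distinct vertices are joined according to their labels alone, so any bijection preserving labels
    is an isomorphism; [f] matches the enumerations of corresponding classes. *)
Lemma isomorphic_of_labels (G H : sgraph) (l : G -> nat) (l' : H -> nat) (M : rel nat) :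
    0 < #|H| ->
    (forall x y : G, adj x y = (x != y) && M (l x) (l y)) ->
    (forall x y : H, adj x y = (x != y) && M (l' x) (l' y)) ->
    #|G| = #|H| ->
    (forall a, #|[set x | l x == a]| = #|[set y | l' y == a]|) ->
  isomorphic G H.
Proof.
case/card_gt0P=> d _ adjG adjH cardGH card_l.
pose A a := enum [set x | l x == a]; pose B a := enum [set y | l' y == a].
have szAB a : size (A a) = size (B a) by rewrite -!cardE.
pose f x := nth d (B (l x)) (index x (A (l x))).
have ltB x : index x (A (l x)) < size (B (l x)).
  by rewrite -szAB index_mem mem_enum inE.
have lf x : l' (f x) = l x.
  by have := mem_nth d (ltB x); rewrite mem_enum inE => /eqP.
have injf : injective f.
  move=> x y fxy; have lxy : l x = l y by rewrite -!lf fxy.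
  have xA : x \in A (l x) by rewrite mem_enum inE.
  move: fxy; rewrite /f => /eqP; rewrite -lxy nth_uniq ?enum_uniq ?ltB //; last first.
    by rewrite lxy ltB.
  move/eqP/(congr1 (nth x (A (l x)))); rewrite !nth_index //.
  by rewrite lxy mem_enum inE.
exists f; split; first by apply: inj_card_bij; rewrite // cardGH.
by move=> x y; rewrite adjG adjH !lf (inj_eq injf).
Qed.

(** Each edge {a, b} is the image of the two distinct ordered pairs (a, b) and (b, a). *)
Lemma double_edges (G : sgraph) : 2 * #|edges G| <= \sum_(x : G) deg (@adj G) x.
Proof.
rewrite sum_deg_pairs -[leqRHS]sum1_card.
rewrite (partition_big_imset (fun p : G * G => [set p.1; p.2])) /=.
rewrite mulnC -sum_nat_const.
rewrite (_ : edges G = [set [set p.1; p.2] | p in [set p : G * G | adj p.1 p.2]]).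
  apply: leq_sum => E /imsetP[[a b]]; rewrite inE /= => eab ->.
  rewrite sum1_card; apply/card_gt1P; exists (a, b), (b, a); split.
  - by rewrite unfold_in /= inE /= eab eqxx.
  - by rewrite unfold_in /= inE /= adj_sym eab setUC eqxx.
  - by apply: contraTneq eab => -[-> _]; rewrite adj_irrefl.
by apply/setP => E; apply/imsetP/imsetP => -[p ep ->]; exists p.
Qed.

Lemma card_label (T : finType) (l : T -> nat) a :
  #|[set x | l x == a]| = \sum_x (l x == a).
Proof. by rewrite -sum_mem; apply: eq_bigr => x _; rewrite inE. Qed.

Lemma sum_card_labels (T : finType) (l : T -> nat) : (forall x, l x < 4) ->
  #|[set x | l x == 0]| + #|[set x | l x == 1]| + #|[set x | l x == 2]|
    + #|[set x | l x == 3]| = #|T|.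
Proof.
move=> lt4; rewrite !card_label -!big_split /= -sum1_card; apply: eq_bigr => x _.
by case: (l x) (lt4 x) => [|[|[|[|]]]].
Qed.

Definition label (T : finType) (A B D : {set T}) (x : T) : nat :=
  if x \in A then 0 else if x \in B then 1 else if x \in D then 2 else 3.

(** Three class sizes are enough: the fourth class is the remainder, fixed by the number of
    vertices. *)
Lemma isomorphic_of_classes (G H : sgraph) (A B D : {set G}) (l : H -> nat)
    (M : rel nat) :
    0 < #|H| -> [disjoint A & B] -> [disjoint A & D] -> [disjoint B & D] ->
    (forall x y : G, adj x y = (x != y) && M (label A B D x) (label A B D y)) ->
    (forall x y : H, adj x y = (x != y) && M (l x) (l y)) ->
    (forall y, l y < 4) -> #|G| = #|H| ->
    \sum_y (l y == 0) = #|A| -> \sum_y (l y == 1) = #|B| ->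
    \sum_y (l y == 2) = #|D| ->
  isomorphic G H.
Proof.
move=> H_gt0 dAB dAD dBD adjG adjH lt4 cardGH l0 l1 l2.
apply: (isomorphic_of_labels H_gt0 adjG adjH cardGH).
have lab4 x : label A B D x < 4 by rewrite /label; do 3![case: ifP => // _].
have lab0 : #|[set x | label A B D x == 0]| = #|A|.
  apply: eq_card => x; rewrite inE /label.
  by case: (x \in A) => //; do 2![case: ifP => // _].
have lab1 : #|[set x | label A B D x == 1]| = #|B|.
  apply: eq_card => x; rewrite inE /label.
  case Ax: (x \in A); first by rewrite (disjointFr dAB Ax).
  by case: (x \in B) => //; case: ifP.
have lab2 : #|[set x | label A B D x == 2]| = #|D|.
  apply: eq_card => x; rewrite inE /label.
  case Ax: (x \in A); first by rewrite (disjointFr dAD Ax).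
  case Bx: (x \in B); first by rewrite (disjointFr dBD Bx).
  by case: (x \in D).
have := sum_card_labels lab4; have := sum_card_labels lt4.
rewrite -cardGH !lab0 !lab1 !lab2 -!card_label in l0 l1 l2 *.
rewrite l0 l1 l2 => sumH sumG [|[|[|[|a]]]]; rewrite ?lab0 ?lab1 ?lab2 ?l0 ?l1 ?l2 //.
  by lia.
rewrite !card_label !big1 // => x _; first by have := lt4 x; case: eqP => // ->.
by have := lab4 x; case: eqP => // ->.
Qed.

(** * Recognition of the exceptional graphs *)

Lemma card_copies1 k : #|copies k (K 1)| = k.
Proof. by rewrite card_prod !card_ord muln1. Qed.

Lemma copies1_adj k (x y : copies k (K 1)) : adj x y = false.
Proof.
case: x y => [i u] [j v].
by rewrite /= /copies_adj /= /complete_adj (ord1 u) (ord1 v) andbF.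
Qed.

Section Exceptional.
Variables (G : sgraph) (C I : {set G}) (k : nat).
Hypothesis sepCI : separated (@adj G) C I k.

Let CE : #|C| = k. Proof. by case: sepCI. Qed.
Let IE : #|I| = k. Proof. by case: sepCI. Qed.
Let disjCI : [disjoint C & I]. Proof. by case: sepCI. Qed.
Let k_ge2 : 1 < k. Proof. by case: sepCI => _ _ _ /andP[]. Qed.

Lemma adj_missing (x y : G) :
  adj x y = separated_adj C I x y && ((x, y) \notin missing (@adj G) C I).
Proof.
rewrite inE /=; case exy: (adj x y); last by rewrite andbT andbN.
by rewrite andbF (sub_separated_adj (@adj_sym G) (@adj_irrefl G) sepCI).
Qed.

Lemma isomorphic_join_union :
    missing (@adj G) C I = set0 ->
  isomorphic G (K k \vee (K (#|G| - 2 * k) + copies k (K 1))).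
Proof.
move=> missing0; case: (sepCI) => _ _ _ /andP[_ lt_k] _.
set H := (X in isomorphic _ X).
pose l (x : H) :=
  match x with inl _ => 0 | inr (inl _) => 3 | inr (inr _) => 1 end.
have cardH : #|H| = #|G|.
  by rewrite !card_sum card_copies1 !card_ord; lia.
apply: (isomorphic_of_classes (A := C) (B := I) (D := set0) (l := l)
  (M := fun a b => [|| a == 0, b == 0 | (a == 3) && (b == 3)])) => //.
- by rewrite cardH; lia.
- by rewrite disjoint_sym disjoints_subset sub0set.
- by rewrite disjoint_sym disjoints_subset sub0set.
- move=> x y; rewrite adj_missing missing0 inE andbT /separated_adj /label !inE.
  congr (_ && _); have := disjointFr disjCI (x := x); have := disjointFr disjCI (x := y).
  by case: (x \in C); case: (y \in C); case: (x \in I); case: (y \in I) => //= h1 h2;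
     rewrite ?h1 ?h2.
- case=> [x|[x|x]] [y|[y|y]] //=; rewrite ?andbF ?andbT //.
  exact: copies1_adj.
- by case=> [x|[x|x]].
- by rewrite !big_sumType /= !sum_nat_const !card_ord ?card_copies1 CE; lia.
- by rewrite !big_sumType /= !sum_nat_const !card_ord ?card_copies1 IE; lia.
- by rewrite !big_sumType /= !sum_nat_const !card_ord ?card_copies1 cards0; lia.
Qed.

Hypothesis cardG : #|G| = 2 * k + 1.

(** Only one vertex lies outside [C] and [I], so the complement of [C] is independent; two such
    vertices would bring the count to 2k + 2. *)
Lemma separated_adj_odd (x y : G) :
  separated_adj C I x y = (x != y) && ((x \in C) || (y \in C)).
Proof.
rewrite /separated_adj orbA; case: eqVneq => //= neq_xy.
case: (boolP ((x \in C) || (y \in C))) => //=; rewrite negb_or => /andP[nCx nCy].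
apply/negP => /andP[nIx nIy].
have : #|x |: (y |: (C :|: I))| <= #|G| by exact: max_card.
rewrite !cardsU1 cardsU (disjoint_setI0 disjCI) cards0 !inE !negb_or neq_xy.
by rewrite nCx nCy nIx nIy CE IE cardG; clear; lia.
Qed.

Lemma isomorphic_join_copies :
  missing (@adj G) C I = set0 -> isomorphic G (K k \vee copies k.+1 (K 1)).
Proof.
move=> missing0; set H := (X in isomorphic _ X).
pose l (x : H) := match x with inl _ => 0 | inr _ => 3 end.
have cardH : #|H| = #|G| by rewrite card_sum card_copies1 card_ord cardG; lia.
apply: (isomorphic_of_classes (A := C) (B := set0) (D := set0) (l := l)
  (M := fun a b => (a == 0) || (b == 0))) => //.
- by rewrite cardH cardG addn1.
- by rewrite disjoint_sym disjoints_subset sub0set.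
- by rewrite disjoint_sym disjoints_subset sub0set.
- by rewrite disjoints_subset sub0set.
- move=> x y; rewrite adj_missing missing0 inE andbT separated_adj_odd /label !inE.
  by case: (x \in C); case: (y \in C).
- case=> [x|x] [y|y] //=; rewrite ?andbF ?andbT //.
  exact: copies1_adj.
- by case.
- by rewrite big_sumType /= !sum_nat_const !card_ord ?card_copies1 CE; lia.
- by rewrite big_sumType /= !sum_nat_const !card_ord ?card_copies1 cards0; lia.
- by rewrite big_sumType /= !sum_nat_const !card_ord ?card_copies1 cards0; lia.
Qed.

Variables a b : G.
Hypothesis missing_ab : (a, b) \in missing (@adj G) C I.
Hypothesis missing_le2 : #|missing (@adj G) C I| <= 2.

Let neq_ab : a != b.
Proof. by move: missing_ab; rewrite inE => /andP[/andP[]]. Qed.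

(** [missing] is symmetric with at most two elements, so it consists of (a, b) and (b, a). *)
Lemma adj_but_one (x y : G) :
  adj x y = [&& x != y, (x \in C) || (y \in C) &
    ~~ ((x == a) && (y == b) || (x == b) && (y == a))].
Proof.
have missingE : missing (@adj G) C I = [set (a, b); (b, a)].
  apply/eqP; rewrite eq_sym eqEcard cards2 xpair_eqE negb_and neq_ab /= missing_le2 andbT.
  apply/subsetP => p; rewrite !inE => /orP[]/eqP -> /=; move: missing_ab; rewrite !inE //=.
  by rewrite separated_adjC adj_sym.
by rewrite adj_missing missingE separated_adj_odd !inE !xpair_eqE -andbA.
Qed.

(** When the missing edge lies inside [C], the graph is K_(k-2) \/ 2K_1 \/ (k+1)K_1. [H] stays
    abstract because the targets for k = 3 and k = 4 are written differently. *)
Lemma isomorphic_inner (H : sgraph) (l : H -> nat) :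
    a \in C -> b \in C -> #|H| = 2 * k + 1 ->
    (forall x y : H, adj x y = (x != y) && ((l x == 0) || (l x != l y))) ->
    (forall y, l y < 4) -> \sum_y (l y == 0) = k - 2 -> \sum_y (l y == 1) = 2 ->
    \sum_y (l y == 2) = 0 ->
  isomorphic G H.
Proof.
move=> Ca Cb cardH adjH lt4 l0 l1 l2.
have sub_ab : [set a; b] \subset C by apply/subsetP => x /set2P[] ->.
apply: (isomorphic_of_classes (A := C :\: [set a; b]) (B := [set a; b]) (D := set0)
  (M := fun i j => (i == 0) || (i != j)) (l := l)) => //.
- by rewrite cardH addn1.
- by rewrite disjoint_sym disjoints_subset; apply/subsetP => x; rewrite !inE => ->.
- by rewrite disjoint_sym disjoints_subset sub0set.
- by rewrite disjoint_sym disjoints_subset sub0set.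
- move=> x y; rewrite adj_but_one /label !inE.
  have xaC : (x == a) ==> (x \in C) by apply/implyP => /eqP ->.
  have xbC : (x == b) ==> (x \in C) by apply/implyP => /eqP ->.
  have yaC : (y == a) ==> (y \in C) by apply/implyP => /eqP ->.
  have ybC : (y == b) ==> (y \in C) by apply/implyP => /eqP ->.
  have xyab : [&& x != y, (x == a) || (x == b) & (y == a) || (y == b)] ==>
     ((x == a) && (y == b) || (x == b) && (y == a)).
    apply/implyP => /and3P[nxy /orP[]/eqP xE /orP[]/eqP yE]; rewrite xE yE ?eqxx ?orbT //.
      by rewrite xE yE eqxx in nxy.
    by rewrite xE yE eqxx in nxy.
  move: xaC xbC yaC ybC xyab.
  case: (x == y) => //; case: (x == a); case: (x == b); case: (y == a); case: (y == b);
  by case: (x \in C); case: (y \in C).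
- by rewrite cardH.
- by rewrite l0 cardsD (setIidPr sub_ab) cards2 neq_ab CE.
- by rewrite l1 cards2 neq_ab.
- by rewrite l2 cards0.
Qed.

(** Apart from the k - 1 universal vertices of [C] other than [a], the vertex [b] is isolated and
    [a] is the centre of a star on the other [k] vertices outside [C]. *)
Lemma isomorphic_cross :
  a \in C -> b \notin C -> isomorphic G (K k.-1 \vee (K 1 + Kbip 1 k)).
Proof.
move=> Ca nCb; set H := (X in isomorphic _ X).
pose l (x : H) := match x with
  | inl _ => 0 | inr (inl _) => 2 | inr (inr (inl _)) => 1 | _ => 3 end.
have cardH : #|H| = 2 * k + 1 by rewrite !card_sum !card_ord; lia.
apply: (isomorphic_of_classes (A := C :\ a) (B := [set a]) (D := [set b]) (l := l)
  (M := fun i j => [|| i == 0, j == 0, (i == 1) && (j == 3) | (i == 3) && (j == 1)])) => //.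
- by rewrite cardH addn1.
- by rewrite disjoint_sym disjoints1 !inE eqxx.
- by rewrite disjoint_sym disjoints1 !inE negb_and nCb orbT.
- by rewrite disjoints1 inE.
- move=> x y; rewrite adj_but_one /label !inE.
  have xaC : (x == a) ==> (x \in C) by apply/implyP => /eqP ->.
  have xbC : (x == b) ==> (x \notin C) by apply/implyP => /eqP ->.
  have yaC : (y == a) ==> (y \in C) by apply/implyP => /eqP ->.
  have ybC : (y == b) ==> (y \notin C) by apply/implyP => /eqP ->.
  have xyab : (x != y) ==> ~~ ((x == a) && (y == a) || (x == b) && (y == b)).
    by apply/implyP; apply: contra => /orP[]/andP[/eqP -> /eqP ->].
  move: xaC xbC yaC ybC xyab.
  case: (x == y) => //; case: (x == a); case: (x == b); case: (y == a); case: (y == b);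
  by case: (x \in C); case: (y \in C).
- case=> [x|[x|[x|x]]] [y|[y|[y|y]]] //=; rewrite ?andbF ?andbT //.
  by rewrite /complete_adj (ord1 x) (ord1 y).
- by case=> [x|[x|[x|x]]].
- by rewrite cardG cardH.
- by rewrite !big_sumType /= !sum_nat_const !card_ord; have := cardsD1 a C; rewrite Ca CE; lia.
- by rewrite !big_sumType /= !sum_nat_const !card_ord cards1; lia.
- by rewrite !big_sumType /= !sum_nat_const !card_ord cards1; lia.
Qed.

End Exceptional.

Lemma exceptional_of_separated (G : sgraph) (C I : {set G}) (k : nat) :
    separated (@adj G) C I k ->
    (#|G| - 2) * (#|G| - 3) + 8 <= \sum_(x : G) deg (@adj G) x ->
  exceptional #|G| G.
Proof.
move=> sep sum_ge; rewrite /exceptional.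
case: (separated_parameters (@adj_sym G) (@adj_irrefl G) sep sum_ge).
- by case=> kE /cards0_eq m0; left; have := isomorphic_join_union sep m0; rewrite kE.
- case=> kE nE /cards0_eq m0; do 2 right; left.
  by have := isomorphic_join_union sep m0; rewrite kE nE.
- case=> kE nE /cards0_eq m0; right; left; have := isomorphic_join_copies sep.
  by rewrite kE; apply.
case=> kE nE le2; have [m0|[[a b] mab]] := set_0Vmem (missing (@adj G) C I).
  have iso := isomorphic_join_copies sep nE m0.
  by case: kE iso => ->; [do 9 right | do 6 right; left].
(* A missing edge meets [C], and [missing] is symmetric, so [a] may be taken as its end in [C]. *)
wlog Ca : a b mab / a \in C.
  move=> IH; have mba : (b, a) \in missing (@adj G) C I.
    by move: mab; rewrite !inE /= separated_adjC adj_sym.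
  move: (mab); rewrite inE (separated_adj_odd sep nE) => /andP[/andP[_ /orP[Ca|Cb]] _].
    exact: IH mab Ca.
  exact: IH mba Cb.
have [Cb|nCb] := boolP (b \in C); last first.
  have iso := isomorphic_cross sep nE mab le2 Ca nCb.
  by case: kE iso => ->; [do 8 right; left | do 3 right; left].
have iso := isomorphic_inner sep nE mab le2 Ca Cb.
case: kE iso => -> iso; [do 7 right; left | do 5 right; left].
  pose l (x : (Kbip 1 2 \vee copies 4 (K 1))%graph) :=
    match x with inl (inl _) => 0 | inl (inr _) => 1 | inr _ => 3 end.
  apply: (iso _ l).
  - by rewrite !card_sum card_copies1 !card_ord.
  - case=> [[x|x]|x] [[y|y]|y] //=; rewrite ?andbF ?andbT //; last exact: copies1_adj.
    by rewrite (ord1 x) (ord1 y) eqxx.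
  - by case=> [[x|x]|x].
  - by rewrite !big_sumType /= !sum_nat_const !card_ord ?card_copies1.
  - by rewrite !big_sumType /= !sum_nat_const !card_ord ?card_copies1.
  - by rewrite !big_sumType /= !sum_nat_const !card_ord ?card_copies1.
pose l (x : (K 2 \vee copies 2 (K 1) \vee copies 5 (K 1))%graph) :=
  match x with inl (inl _) => 0 | inl (inr _) => 1 | inr _ => 3 end.
apply: (iso _ l).
- by rewrite !card_sum !card_copies1 !card_ord.
- case=> [[x|x]|x] [[y|y]|y] //=; rewrite ?andbF ?andbT //; exact: copies1_adj.
- by case=> [[x|x]|x].
- by rewrite !big_sumType /= !sum_nat_const !card_ord ?card_copies1.
- by rewrite !big_sumType /= !sum_nat_const !card_ord ?card_copies1.
- by rewrite !big_sumType /= !sum_nat_const !card_ord ?card_copies1.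
Qed.

(** * Assembly of the hamiltonian and non-hamiltonian cases *)

Lemma bigminn_leq (T : eqType) (r : seq T) (F : T -> nat) (d : nat) (x : T) :
  x \in r -> \big[minn/d]_(y <- r) F y <= F x.
Proof.
elim: r => // y r IHr; rewrite inE big_cons => /orP[/eqP ->|/IHr]; first exact: geq_minl.
exact/leq_trans/geq_minr.
Qed.

Theorem theorem3p1 (G : sgraph) (n m : nat)
  (hn : #|G| = n) (hm : #|edges G| = m)
  (n_ge5 : 5 <= n)
  (G_conn : connected G)
  (G_mindeg : 2 <= min_degree G)
  (m_ge : 'C(n - 2, 2) + 4 <= m) :
  pancyclic G \/ bipartite G \/ exceptional n G.
Proof.
move: hn hm => <- <- in n_ge5 m_ge *.
have deg_ge2 (x : G) : 2 <= deg (@adj G) x.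
  exact: leq_trans G_mindeg (bigminn_leq _ _ (mem_index_enum x)).
(* Doubling the edge bound gives (n - 2)(n - 3) + 8. *)
have sum_ge : (#|G| - 2) * (#|G| - 3) + 8 <= \sum_(x : G) deg (@adj G) x.
  apply: leq_trans (double_edges G); have := bin_ffact (#|G| - 2) 2.
  rewrite ffactnS ffactn1 (_ : (#|G| - 2).-1 = #|G| - 3); last by lia.
  by move: m_ge; rewrite (_ : 2`! = 2) //; clear; lia.
(* Tuples of length n form a finite type, so hamiltonicity is decided by a boolean search. *)
have [/existsP[t cyc_t]|nham] := boolP [exists t : #|G|.-tuple G, ucycleb (@adj G) t].
  left=> l l_range; apply: cycles_of_hamiltonian l_range; last 1 first.
  - move: sum_ge n_ge5; move: #|G| (\sum_x _) => N S; clear => sum_ge n_ge5.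
    (* For n = q + 5 the required inequality has margin at least q^2 + 3. *)
    have [q NE] : exists q, N = q + 5 by exists (N - 5); lia.
    rewrite NE (_ : q + 5 - 2 = q + 3) 1?(_ : q + 5 - 3 = q + 2) in sum_ge *; [|by lia..].
    by nia.
  - exact: adj_sym.
  - exact: adj_irrefl.
  - by exists t; rewrite size_tuple.
right; right.
have [] := separated_of_not_hamiltonian (@adj_sym G) (@adj_irrefl G) n_ge5 _ deg_ge2 sum_ge.
  case=> c [cyc_c cE]; case/existsP: nham.
  by exists (Tuple (introT eqP cE)).
by move=> C [I [k sep]]; exact: exceptional_of_separated sep sum_ge.
Qed.
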